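(* For $k\ge 4$, there exists no randomized algorithm for the $k$-MPMD problem on $n$-metrics against an oblivious adversary that has a competitive ratio which is bounded by a function of the number of points $n$.
   Context: The $k$-MPMD problem: a finite generalized metric space $(V,d)$ with $|V|=n$ and $d:V^k\to[0,\infty)$ is given. Requests arrive online; each request $\rho$ has a location $\ell(\rho)\in V$ and an arrival time $t(\rho)\ge 0$. The algorithm must irrevocably partition the request sequence $R$ (of size a multiple of $k$) into sets of exactly $k$ requests; a set can be formed at any time after all its members have arrived. Matching $\{\rho_1,\dots,\rho_k\}$ incurs space cost $d(\ell(\rho_1),\dots,\ell(\rho_k))$, and a request $\rho$ matched at time $t'(\rho)$ incurs time cost $t'(\rho)-t(\rho)$. The total cost is the sum of space and time costs; $\mathrm{cost}_{\mathcal{OPT}}(R)$ is the optimal offline cost. The competitive ratio of a randomized algorithm $\mathcal{ALG}$ is $\sup_R \mathbb{E}[\mathrm{cost}_{\mathcal{ALG}}(R)]/\mathrm{cost}_{\mathcal{OPT}}(R)$, with $R$ chosen by an oblivious adversary. An $n$-metric on $V$ (for $k$ points) is a function $d:V^k\to[0,\infty)$ such that for all $v_1,\dots,v_k,a\in V$: ($\Pi$) $d(v_1,\dots,v_k)$ is invariant under permutations of its arguments; ($O_D$) $d(v_1,\dots,v_k)=0$ if and only if $v_1=\dots=v_k$, and $d(v_1,\dots,v_k)>0$ otherwise; ($\Delta_n$) $d(v_1,\dots,v_k)\le d(v_1,\dots,v_{k-1},a)+d(a,\dots,a,v_k)$, where $a$ appears $k-1$ times in the last term. *)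

(* Defs.v *)
From HB Require Import structures.
From mathcomp Require Import all_boot all_order all_algebra.
From mathcomp Require Import perm.
From mathcomp Require Import all_classical all_reals all_analysis.

Set Implicit Arguments.
Unset Strict Implicit.
Unset Printing Implicit Defensive.

Import Order.TTheory GRing.Theory Num.Theory.

Local Open Scope classical_set_scope.
Local Open Scope ring_scope.

(* Points of V^k are finite functions 'I_k -> V; the last coordinate is the one
   whose index i satisfies i.+1 = k. *)
Record n_metric (R : realType) (k : nat) (V : finType) := NMetric {
  nm_dist :> {ffun 'I_k -> V} -> R;
  nm_ge0 : forall v : {ffun 'I_k -> V}, 0 <= nm_dist v;
  nm_perm : forall (v : {ffun 'I_k -> V}) (s : 'S_k),
    nm_dist [ffun i => v (s i)] = nm_dist v;
  nm_eq0 : forall v : {ffun 'I_k -> V},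
    nm_dist v = 0 <-> (forall i j, v i = v j);
  nm_triangle : forall (v : {ffun 'I_k -> V}) (a : V),
    nm_dist v <= nm_dist [ffun i : 'I_k => if i.+1 == k then a else v i]
               + nm_dist [ffun i : 'I_k => if i.+1 == k then v i else a]
}.

Section KMPMD.
Context {R : realType} {k : nat} {V : finType}.

(* (location, arrival time) *)
Definition request : Type := (V * R)%type.

Definition is_input (r : seq request) : Prop :=
  [/\ sorted (fun p q : request => p.2 <= q.2) r,
      all (fun p : request => 0 <= p.2) r
    & (k %| size r)%N].

Definition loc (r : seq request) (i : 'I_(size r)) : V := (tnth (in_tuple r) i).1.
Definition arrival (r : seq request) (i : 'I_(size r)) : R :=
  (tnth (in_tuple r) i).2.

(* A request is identified by its position in the input.  A schedule lists the
   sets that are formed, each one as an enumeration of its k members together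
   with the time at which it is formed. *)
Definition schedule (r : seq request) : Type :=
  seq (k.-tuple 'I_(size r) * R).

Definition valid_schedule (r : seq request) (M : schedule r) : Prop :=
  perm_eq (flatten [seq tval x.1 | x <- M]) (enum 'I_(size r)) /\
  (forall x, x \in M -> forall i, i \in x.1 -> arrival i <= x.2).

Definition cost (d : n_metric R k V) (r : seq request) (M : schedule r) : R :=
  \sum_(x <- M) (d [ffun j : 'I_k => loc (tnth x.1 j)]
                 + \sum_(i <- x.1) (x.2 - arrival i)).

Definition cost_opt (d : n_metric R k V) (r : seq request) : \bar R :=
  ereal_inf [set (cost d M)%:E | M in [set M : schedule r | valid_schedule M]].

(* The requests that have arrived by time t; on a sorted input this is a prefix,
   so that positions are preserved. *)
Definition arrived (r : seq request) (t : R) : seq request :=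
  [seq p <- r | p.2 <= t].

(* The sets formed up to time t depend only on the requests arrived up to time t;
   sets are compared independently of the chosen enumeration of their members. *)
Definition nonanticipating (A : forall r : seq request, schedule r) : Prop :=
  forall (r1 r2 : seq request) (t : R), is_input r1 -> is_input r2 ->
  arrived r1 t = arrived r2 t ->
  forall x, x \in A r1 -> x.2 <= t ->
  exists2 y, y \in A r2 &
    y.2 = x.2 /\ perm_eq [seq val i | i <- y.1] [seq val i | i <- x.1].

Definition online_algorithm (A : forall r : seq request, schedule r) : Prop :=
  (forall r, is_input r -> valid_schedule (A r)) /\ nonanticipating A.

End KMPMD.

(* A random choice of a deterministic online algorithm. *)
Record randomized_algorithm (R : realType) (k : nat) (V : finType)
    (d : n_metric R k V) := RandomizedAlgorithm {
  ra_display : measure_display;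
  ra_space : measurableType ra_display;
  ra_prob : probability ra_space R;
  ra_run : ra_space -> forall r : seq (@request R V), schedule (k := k) r;
  ra_online : forall w, online_algorithm (ra_run w);
  ra_measurable : forall r, is_input (k := k) r ->
    measurable_fun setT (fun w => cost d (ra_run w r))
}.

Arguments ra_run {R k V d} _ _ _.

Definition expected_cost (R : realType) (k : nat) (V : finType)
    (d : n_metric R k V) (A : randomized_algorithm d) (r : seq request) : \bar R :=
  ('E_(ra_prob A)[fun w => cost d (ra_run A w r)])%E.

(* The input r is fixed independently of the random choice (oblivious adversary).
   In \bar R one has x / 0 = +oo for x > 0 and 0 / 0 = 0. *)
Definition competitive_ratio (R : realType) (k : nat) (V : finType)
    (d : n_metric R k V) (A : randomized_algorithm d) : \bar R :=
  ereal_sup [set (expected_cost A r / cost_opt d r)%E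
            | r in [set r : seq request | is_input (k := k) r]].

(* Main.v *)
(** The triangle inequality of an n-metric only constrains sets of the shape
    (a, ..., a, b): once these cost 1, every other non-constant set may have any
    symmetric cost in ]0, 1].  On three points p, q, s, let a set cost e if it has
    at least two members at p and at least two elsewhere, and 1 if it is any
    other non-constant set.
    On the input made of k requests at p at time 0 the optimum is 0, so an
    algorithm with finite ratio almost surely matches them at time 0.  If then
    one request at s and k-1 requests at q arrive at time e, they must be matched
    together at cost 1, whereas mixing both batches into two sets of cost e is
    possible for O(k e) in total.  Let e tend to 0. *)
Require Import Defs.
From mathcomp Require Import all_boot all_order all_algebra.
From mathcomp Require Import perm zify lra.
From mathcomp Require Import all_classical all_reals all_analysis measurable_realfun.

Import Order.TTheory GRing.Theory Num.Theory.
Local Open Scope ring_scope.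

(** * The metric in which only balanced mixtures around [p] are cheap *)

Definition splits {k : nat} {V : finType} (p : V) (v : {ffun 'I_k -> V}) : bool :=
  (1 < #|[set i | v i == p]|)%N && (1 < #|[set i | v i != p]|)%N.

Definition gap_dist {R : realType} {k : nat} {V : finType} (e : R) (p : V)
    (v : {ffun 'I_k -> V}) : R :=
  if [forall i, forall j, v i == v j] then 0
  else if splits p v then e else 1.

Lemma splits_perm {k : nat} {V : finType} (p : V) (v : {ffun 'I_k -> V})
    (s : 'S_k) :
  splits p [ffun i => v (s i)] = splits p v.
Proof.
rewrite /splits -(card_preimset [set i | v i == p] (@perm_inj _ s)).
rewrite -(card_preimset [set i | v i != p] (@perm_inj _ s)).
by congr (_ && _); congr (1 < _)%N; apply: eq_card => i; rewrite !inE ffunE.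
Qed.

(** Only one index is last, so at most one coordinate differs from [a]: if [a = p], too few lie off
    [p], otherwise too few lie at [p]. *)
Lemma splits_but_last {k : nat} {V : finType} (p a : V) (v : {ffun 'I_k -> V}) :
  splits p [ffun i : 'I_k => if i.+1 == k then v i else a] = false.
Proof.
have lastS : (#|[set i : 'I_k | i.+1 == k]| <= 1)%N.
  apply/card_le1_eqP => i j; rewrite !inE => /eqP ik /eqP jk.
  by apply/val_inj/succn_inj; rewrite ik jk.
apply/negbTE; rewrite negb_and -!leqNgt.
have [->|ap] := eqVneq a p; apply/orP; [right|left];
  apply: leq_trans lastS; apply/subset_leq_card/fintype.subsetP => i;
  rewrite !inE ffunE; case: ifP => //.
  by rewrite eqxx.
by rewrite (negbTE ap).
Qed.

Section Gap.
Context {R : realType} {k : nat} {V : finType} (e : R) (p : V).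
Hypotheses (hk : (2 <= k)%N) (e_gt0 : 0 < e) (e_le1 : e <= 1).

Lemma gap_dist_ge0 (v : {ffun 'I_k -> V}) : 0 <= gap_dist e p v.
Proof. by rewrite /gap_dist; do 2 case: ifP => // _; exact: ltW. Qed.

Lemma gap_dist_le1 (v : {ffun 'I_k -> V}) : gap_dist e p v <= 1.
Proof. by rewrite /gap_dist; do 2 case: ifP => //. Qed.

Lemma gap_dist_splits (v : {ffun 'I_k -> V}) : splits p v -> gap_dist e p v <= e.
Proof. by move=> pv; rewrite /gap_dist pv; case: ifP => // _; exact: ltW. Qed.

Lemma gap_dist_eq0 (v : {ffun 'I_k -> V}) :
  gap_dist e p v = 0 <-> (forall i j, v i = v j).
Proof.
rewrite /gap_dist; split=> [|cv].
  case: ifP => [/forallP cv _ i j|_]; first exact/eqP/(forallP (cv i)).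
  by case: ifP => _ /eqP; rewrite ?oner_eq0 ?gt_eqF.
by rewrite ifT//; apply/forallP => i; apply/forallP => j; rewrite (cv i j).
Qed.

Lemma gap_dist_perm (v : {ffun 'I_k -> V}) (s : 'S_k) :
  gap_dist e p [ffun i => v (s i)] = gap_dist e p v.
Proof.
rewrite /gap_dist splits_perm; congr (if _ then _ else _).
apply/forallP/forallP => cv i; apply/forallP => j; last first.
  by rewrite !ffunE; exact: (forallP (cv _)).
by have := forallP (cv ((s^-1)%g i)) ((s^-1)%g j); rewrite !ffunE !permKV.
Qed.

(* Replacing the last argument by a different point costs a full unit, which
   bounds every distance: so any values in ]0, 1] elsewhere are allowed. *)
Lemma gap_dist_triangle (v : {ffun 'I_k -> V}) (a : V) :
  gap_dist e p v <=
    gap_dist e p [ffun i : 'I_k => if i.+1 == k then a else v i]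
    + gap_dist e p [ffun i : 'I_k => if i.+1 == k then v i else a].
Proof.
have lk : (k.-1 < k)%N by lia.
have fk : (0 < k)%N by lia.
pose l := Ordinal lk; pose f := Ordinal fk.
have lastP (i : 'I_k) : (i.+1 == k) = (i == l).
  by apply/eqP/eqP => [ik|->]; [apply/val_inj|]; rewrite /=; lia.
have [val|vNa] := eqVneq (v l) a.
  have -> : [ffun i : 'I_k => if i.+1 == k then a else v i] = v.
    by apply/ffunP => i; rewrite ffunE lastP; case: eqP => // ->.
  by rewrite lerDl gap_dist_ge0.
suff -> : gap_dist e p [ffun i : 'I_k => if i.+1 == k then v i else a] = 1.
  by apply: le_trans (gap_dist_le1 v) _; rewrite lerDr gap_dist_ge0.
(* As [k >= 2], the index [f] differs from the last one [l], so the tuple takes both values [a] and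
   [v l]. *)
rewrite /gap_dist splits_but_last ifF//; apply/negP => /forallP/(_ l)/forallP.
move=> /(_ f); rewrite !ffunE !lastP eqxx.
have -> : (f == l) = false by apply/negP => /eqP/(congr1 val) /=; lia.
by rewrite (negbTE vNa).
Qed.

Definition gap_metric : n_metric R k V :=
  NMetric gap_dist_ge0 gap_dist_perm gap_dist_eq0 gap_dist_triangle.

End Gap.

(** * Elementary bounds on the cost of valid schedules *)

Section Schedules.
Context {R : realType} {k : nat} {V : finType} (d : n_metric R k V).

Lemma waiting_ge0 {r : seq (@request R V)} {M : schedule (k := k) r} {x} :
  valid_schedule M -> x \in M -> 0 <= \sum_(i <- x.1) (x.2 - arrival i).
Proof.
move=> [_ late] xM; rewrite big_seq; apply: sumr_ge0 => i ix.
by rewrite subr_ge0; exact: late.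
Qed.

Lemma set_cost_le {r : seq (@request R V)} {M : schedule (k := k) r} {x} :
  valid_schedule M -> x \in M ->
  d [ffun j => loc (tnth x.1 j)] + \sum_(i <- x.1) (x.2 - arrival i)
    <= cost d M.
Proof.
move=> vM xM; rewrite /cost (big_rem x)//= lerDl big_seq.
apply: sumr_ge0 => y /mem_rem yM; apply: addr_ge0; first exact: nm_ge0.
exact: waiting_ge0 vM yM.
Qed.

Lemma cost_ge0 {r : seq (@request R V)} {M : schedule (k := k) r} :
  valid_schedule M -> 0 <= cost d M.
Proof.
move=> vM; rewrite /cost big_seq; apply: sumr_ge0 => y yM.
by rewrite addr_ge0 ?nm_ge0// (waiting_ge0 vM).
Qed.

Lemma cost_opt_ge0 (r : seq (@request R V)) : (0 <= cost_opt d r)%E.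
Proof.
by apply: le_ereal_inf_tmp => _ [M vM <-]; rewrite lee_fin; exact: cost_ge0.
Qed.

Lemma cost_opt_le {r : seq (@request R V)} {M : schedule (k := k) r} :
  valid_schedule M -> (cost_opt d r <= (cost d M)%:E)%E.
Proof. by move=> vM; apply: ereal_inf_lbound; exists M. Qed.

Lemma size_valid_schedule {r : seq (@request R V)} {M : schedule (k := k) r} :
  valid_schedule M -> (size M * k)%N = size r.
Proof.
move=> [/perm_size + _]; rewrite size_enum_ord size_flatten /shape -map_comp.
move=> szM; rewrite -[RHS]szM (eq_map (g := fun=> k)); last by move=> x /=; rewrite size_tuple.
by rewrite sumnE big_map big_const_seq count_predT iter_addn_0 mulnC.
Qed.

End Schedules.

(** * Quotients of extended reals, including division by zero *)

Lemma le_ratio {R : realType} (C : R) (x y : \bar R) :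
  0 < C -> (1 <= x)%E -> (0 <= y)%E -> (y <= (C^-1)%:E)%E -> (C%:E <= x / y)%E.
Proof.
move=> C0 x1; case: y => [y| |] //; rewrite !lee_fin => y0 yC.
(* For [y = 0] the quotient is [+oo], because [x >= 1] is positive. *)
rewrite inver; case: eqP => [_|/eqP yN0].
  by rewrite gt0_muley ?leey// (lt_le_trans _ x1).
have yp : 0 < y by rewrite lt_def yN0.
apply: (@le_trans _ _ (1 * (y^-1)%:E)%E).
  by rewrite mul1e lee_fin -(invrK C) lef_pV2 ?posrE ?invr_gt0.
by apply: lee_wpmul2r => //; rewrite lee_fin invr_ge0.
Qed.

Lemma eq0_of_div0_lt_pinfty {R : realType} (x : \bar R) :
  (0 <= x)%E -> (x / 0 < +oo)%E -> x = 0%E.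
Proof.
rewrite le_eqVlt => /orP[/eqP <-//|x0].
by rewrite inve0 gt0_muley// ltxx.
Qed.

(** * The adversary's two inputs *)

Section Trap.
Context {R : realType} {k : nat} {V : finType} (e : R) (p q s : V).
Hypotheses (hk : (4 <= k)%N) (e_gt0 : 0 < e) (e_le1 : e <= 1).
Hypotheses (qp : q != p) (sp : s != p) (qs : q != s).

(** A single infinite stream: its prefix of length [k] is the bait and the one of length [k + k] the
    full trap, so positions agree in both inputs. *)
Definition trap (i : nat) : @request R V :=
  if (i < k)%N then (p, 0) else if i == k then (s, e) else (q, e).

Definition trap_input (n : nat) : seq (@request R V) := mkseq trap n.

Let size_trap n : size (trap_input n) = n := size_mkseq trap n.

Let ltn_trap n (i : 'I_(size (trap_input n))) : (i < n)%N.
Proof. by apply: leq_trans (ltn_ord i) _; rewrite size_trap. Qed.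

Lemma loc_trap n (i : 'I_(size (trap_input n))) : loc i = (trap i).1.
Proof.
rewrite /loc (tnth_nth (trap 0)); congr fst.
exact: (nth_mkseq (trap 0) trap (ltn_trap n i)).
Qed.

Lemma arrival_trap n (i : 'I_(size (trap_input n))) : arrival i = (trap i).2.
Proof.
rewrite /arrival (tnth_nth (trap 0)); congr snd.
exact: (nth_mkseq (trap 0) trap (ltn_trap n i)).
Qed.

Lemma trap_time i : (trap i).2 = if (i < k)%N then 0 else e.
Proof. by rewrite /trap; case: ifP => // _; case: ifP. Qed.

Lemma trap_loc_eq i : ((trap i).1 == p) = (i < k)%N.
Proof.
rewrite /trap; case: ifP => _; first exact: eqxx.
by case: ifP => _; apply/negbTE.
Qed.

Lemma trap_is_input n : (k %| n)%N -> is_input (k := k) (trap_input n).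
Proof.
move=> kn; split; last by rewrite size_trap.
  rewrite sorted_map; apply: sub_sorted (iota_sorted 0 n) => i j ij /=.
  rewrite !trap_time; have := ltW e_gt0.
  by case: ifP => ik; case: ifP => jk //; lia.
by apply/allP => _ /mapP[i _ ->]; rewrite trap_time; case: ifP => // _; exact: ltW.
Qed.

(** The second batch arrives at [e > 0], so at time 0 an online algorithm cannot tell the two inputs
    apart. *)
Lemma arrived_trap : arrived (trap_input k) 0 = arrived (trap_input (k + k)) 0.
Proof.
rewrite /arrived /trap_input /mkseq iotaD map_cat filter_cat add0n.
rewrite [X in _ ++ X](_ : _ = [::]) ?cats0//; apply/eqP.
rewrite -[_ == _]negbK -has_filter; apply/hasPn => _ /mapP[i ik ->].
rewrite mem_iota in ik; rewrite trap_time ifF; last by lia.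
by rewrite -ltNge.
Qed.

(** * Offline optima and the costs forced online *)

Let d : n_metric R k V := gap_metric e p (ltnW (ltnW hk)) e_gt0 e_le1.

Lemma bait_opt : cost_opt d (trap_input k) = 0%E.
Proof.
apply/eqP; rewrite eq_le cost_opt_ge0 andbT.
pose x : k.-tuple 'I_(size (trap_input k)) :=
  tcast (etrans (card_ord _) (size_trap k))
    (enum_tuple 'I_(size (trap_input k))).
have vM : valid_schedule [:: (x, 0 : R)].
  split; first by rewrite /= cats0 val_tcast.
  by move=> y /[!inE]/eqP-> i _ /=; rewrite arrival_trap trap_time ltn_trap.
apply: le_trans (cost_opt_le d vM) _; rewrite lee_fin /cost big_seq1 /=.
rewrite big1 ?addr0; last first.
  by move=> i _; rewrite arrival_trap trap_time ltn_trap subr0.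
rewrite le_eqVlt; apply/orP; left; apply/eqP/gap_dist_eq0 => // i j.
have locp u : loc (tnth x u) = p.
  by apply/eqP; rewrite loc_trap trap_loc_eq ltn_trap.
by rewrite !ffunE !locp.
Qed.

Lemma trap_opt : (cost_opt d (trap_input (k + k)) <= (2 * (k.+1)%:R * e)%:E)%E.
Proof.
have lt1 (j : 'I_k) :
    ((if j < 2 then j : nat else k + j) < size (trap_input (k + k)))%N.
  by rewrite size_trap; have := ltn_ord j; case: ifP; lia.
have lt2 (j : 'I_k) :
    ((if j < 2 then k + j else j : nat) < size (trap_input (k + k)))%N.
  by rewrite size_trap; have := ltn_ord j; case: ifP; lia.
(* The two batches exchange all but their first two members: [t1] keeps two requests at [p] and
   takes [k - 2] from elsewhere, and [t2] does the reverse. Since [k >= 4], both sets split. *)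
pose t1 := [tuple Ordinal (lt1 j) | j < k].
pose t2 := [tuple Ordinal (lt2 j) | j < k].
have vals : map val (tval t1 ++ tval t2) =
    mkseq (fun j => if (j < 2)%N then j else (k + j)%N) k
    ++ mkseq (fun j => if (j < 2)%N then (k + j)%N else j) k.
  rewrite map_cat /= -!map_comp /mkseq -val_enum_ord -!map_comp.
  by congr (_ ++ _); apply: eq_map.
have u12 : uniq (tval t1 ++ tval t2).
  rewrite -(map_inj_uniq val_inj) vals cat_uniq.
  apply/and3P; split; last 1 first.
  - rewrite map_inj_in_uniq ?iota_uniq// => i j.
    by rewrite !mem_iota; do 2 case: ifP; lia.
  - rewrite map_inj_in_uniq ?iota_uniq// => i j.
    by rewrite !mem_iota; do 2 case: ifP; lia.
  apply/hasPn => _ /mapP[j jk ->]; apply/negP => /mapP[i ik].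
  by move: jk ik; rewrite !mem_iota; do 2 case: ifP; lia.
have vM : valid_schedule [:: (t1, e); (t2, e)].
  split=> [|y yM i _].
    rewrite /= cats0; apply: uniq_perm; rewrite ?enum_uniq//.
    (* A list of [k + k] distinct positions exhausts all of them. *)
    have [|//] := uniq_min_size u12 (s2 := enum 'I__) (fun i _ => mem_enum _ i).
    by rewrite size_enum_ord size_cat (size_tuple t1) (size_tuple t2) size_trap.
  rewrite arrival_trap trap_time; move: yM; rewrite !inE.
  by move=> /orP[]/eqP-> /=; case: ifP => // _; exact: ltW.
(* Both sets are formed at time [e] and arrivals are nonnegative, so each request waits at most
   [e]. *)
have wait (t : k.-tuple 'I_(size (trap_input (k + k)))) :
    \sum_(i <- t) (e - arrival i) <= k%:R * e.
  apply: (@le_trans _ _ (\sum_(i <- t) e)).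
    apply: ler_sum => i _; rewrite arrival_trap trap_time lerBlDr lerDl.
    by case: ifP => // _; exact: ltW.
  by rewrite big_const_seq count_predT size_tuple iter_addr_0 mulr_natl.
have k0 : (0 < k)%N by lia.
have k1 : (1 < k)%N by lia.
have k2 : (2 < k)%N by lia.
have k3 : (3 < k)%N by lia.
have d1 : d [ffun j => loc (tnth t1 j)] <= e.
  apply: gap_dist_splits => //; apply/andP; split; apply/card_gt1P.
    exists (Ordinal k0), (Ordinal k1); split => //;
    by rewrite inE ffunE tnth_mktuple loc_trap trap_loc_eq /=; lia.
  exists (Ordinal k2), (Ordinal k3); split => //;
  by rewrite inE ffunE tnth_mktuple loc_trap trap_loc_eq /=; lia.
have d2 : d [ffun j => loc (tnth t2 j)] <= e.
  apply: gap_dist_splits => //; apply/andP; split; apply/card_gt1P.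
    exists (Ordinal k2), (Ordinal k3); split => //;
    by rewrite inE ffunE tnth_mktuple loc_trap trap_loc_eq /=; lia.
  exists (Ordinal k0), (Ordinal k1); split => //;
  by rewrite inE ffunE tnth_mktuple loc_trap trap_loc_eq /=; lia.
apply: le_trans (cost_opt_le d vM) _; rewrite lee_fin /cost !big_cons big_nil.
apply: (@le_trans _ _ ((e + k%:R * e) + ((e + k%:R * e) + 0))).
  apply: lerD; first exact: lerD d1 (wait t1).
  by apply: lerD => //; exact: lerD d2 (wait t2).
by rewrite -[k.+1%:R]natr1; lra.
Qed.

(* Once the first k requests are matched among themselves, the last k ones form
   a set without p, which is not constant. *)
Lemma trap_cost (M : schedule (k := k) (trap_input (k + k))) y :
  valid_schedule M -> y \in M -> all (fun i => val i < k)%N (tval y.1) ->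
  1 <= cost d M.
Proof.
move=> vM yM /allP y_lt.
have szM : size M = 2.
  have := etrans (size_valid_schedule vM) (size_trap _).
  by move: (size M) => m; nia.
have pM := perm_to_rem yM.
have [z zE] : exists z, rem y M = [:: z].
  have := perm_size pM; rewrite szM /=.
  by case: (rem y M) => [|z [|? ?]] //; exists z.
have zM : z \in M by apply: (@mem_rem _ y); rewrite zE mem_head.
have yz : perm_eq (tval y.1 ++ tval z.1) (enum 'I_(size (trap_input (k + k)))).
  apply: perm_trans vM.1; rewrite zE in pM.
  have := perm_flatten (perm_map (fun x => tval x.1) pM).
  by rewrite /= cats0 perm_sym.
have uyz : uniq (tval y.1 ++ tval z.1) by rewrite (perm_uniq yz) enum_uniq.
(* The [k] distinct members of [y] lie below [k], so they are all the positions of the first batch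
   and none is left for [z]. *)
have z_ge i : i \in tval z.1 -> (k <= i)%N.
  move=> iz; rewrite leqNgt; apply/negP => ik.
  have : i \in tval y.1.
    have uy : uniq (map val (tval y.1)).
      by rewrite map_inj_uniq; [move: uyz; rewrite cat_uniq => /and3P[]|exact: val_inj].
    have sub : {subset map val (tval y.1) <= iota 0 k}.
      by move=> _ /mapP[j /y_lt jk ->]; rewrite mem_iota.
    have sz : (size (iota 0 k) <= size (map val (tval y.1)))%N.
      by rewrite size_iota size_map size_tuple.
    have : val i \in map val (tval y.1).
      by rewrite (uniq_min_size uy sub sz).2 mem_iota.
    by case/mapP => j jy /val_inj ->.
  move=> iy; move: uyz; rewrite cat_uniq => /and3P[_ /hasPn/(_ _ iz)].
  by rewrite iy.
have z_mem (i : 'I_(size (trap_input (k + k)))) : (k <= i)%N -> i \in tval z.1.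
  move=> ki; have : i \in tval y.1 ++ tval z.1 by rewrite (perm_mem yz) mem_enum.
  by rewrite mem_cat => /orP[/y_lt|//] /=; rewrite ltnNge ki.
have zd : d [ffun j => loc (tnth z.1 j)] = 1.
  rewrite /d /= /gap_dist ifF.
    rewrite ifF//; apply/negbTE; rewrite negb_and -!leqNgt; apply/orP; left.
    rewrite [#|_|](_ : _ = 0%N)//; apply: eq_card0 => j.
    rewrite !inE ffunE loc_trap trap_loc_eq; apply/negbTE; rewrite -leqNgt.
    by apply: z_ge; exact: mem_tnth.
  (* Position [k] is at [s] and position [k.+1] at [q]; [z] contains both, so it is not constant. *)
  have lk : (k < size (trap_input (k + k)))%N by rewrite size_trap; lia.
  have lk1 : (k.+1 < size (trap_input (k + k)))%N by rewrite size_trap; lia.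
  have /tnthP[i iE] := z_mem (Ordinal lk) (leqnn k).
  have /tnthP[j jE] := z_mem (Ordinal lk1) (leqnSn k).
  apply/negP => /forallP/(_ j)/forallP/(_ i); rewrite !ffunE -iE -jE.
  rewrite !loc_trap /trap /= ltnn eqxx ltnNge leqnSn /=.
  by rewrite gtn_eqF// (negbTE qs).
apply: le_trans (set_cost_le d vM zM); rewrite zd lerDl.
exact: waiting_ge0 vM zM.
Qed.

(** Zero cost on the bait forces a set formed by time 0; nonanticipation carries it over to the full
    trap, where [trap_cost] applies. *)
Lemma bait_taken (A : forall r : seq (@request R V), schedule (k := k) r) :
  online_algorithm A -> cost d (A (trap_input k)) = 0 ->
  1 <= cost d (A (trap_input (k + k))).
Proof.
move=> [vA nA] c0.
have inp0 : is_input (k := k) (trap_input k) by apply: trap_is_input.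
have inp1 : is_input (k := k) (trap_input (k + k)).
  by apply: trap_is_input; rewrite dvdn_addr.
have vM := vA _ inp0.
have : (0 < size (A (trap_input k)))%N.
  have := etrans (size_valid_schedule vM) (size_trap _).
  by case: (size _) => //; lia.
case E : (A (trap_input k)) => [//|x M'] _.
have xM : x \in A (trap_input k) by rewrite E mem_head.
have x_lt i : i \in [seq val j | j <- x.1] -> (i < k)%N.
  by move=> /mapP[j _ ->]; exact: ltn_trap.
(* All bait requests arrive at 0, so the waiting cost of [x] is [k] times [x.2], and the total cost
   is zero. *)
have x0 : x.2 <= 0.
  have := set_cost_le d vM xM; rewrite c0.
  have := nm_ge0 d [ffun j => loc (tnth x.1 j)].
  rewrite (eq_bigr (fun=> x.2)); last first.
    by move=> i _; rewrite arrival_trap trap_time ltn_trap subr0.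
  rewrite big_const_seq count_predT size_tuple iter_addr_0 => d0 dx.
  rewrite -(pmulrn_lle0 x.2 (n := k)); last lia.
  by apply: le_trans dx; rewrite lerDr.
have [y yM [_ yx]] := nA _ _ 0 inp0 inp1 arrived_trap x xM x0.
apply: (trap_cost _ y (vA _ inp1) yM); apply/allP => i iy.
by apply: x_lt; rewrite -(perm_mem yx); exact: map_f.
Qed.

Lemma trap_ratio (A : randomized_algorithm d) :
  (competitive_ratio A < +oo)%E ->
  (((2 * (k.+1)%:R * e)^-1)%:E <= competitive_ratio A)%E.
Proof.
have inp0 : is_input (k := k) (trap_input k) by apply: trap_is_input.
have inp1 : is_input (k := k) (trap_input (k + k)).
  by apply: trap_is_input; rewrite dvdn_addr.
have ratio_le r : is_input (k := k) r ->
    (expected_cost A r / cost_opt d r <= competitive_ratio A)%E.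
  by move=> ir; apply: ereal_sup_ubound; exists r.
have c_ge0 r w : is_input (k := k) r -> 0 <= cost d (ra_run A w r).
  by move=> ir; apply: cost_ge0; case: (ra_online w) => vA _; exact: vA.
have mc r : is_input (k := k) r ->
    measurable_fun setT (EFin \o (fun w => cost d (ra_run A w r))).
  by move=> ir; apply/measurable_EFinP; exact: ra_measurable.
move=> fin.
have E0 : expected_cost A (trap_input k) = 0%E.
  apply: eq0_of_div0_lt_pinfty.
    rewrite /expected_cost unlock; apply: integral_ge0 => w _.
    by rewrite lee_fin c_ge0.
  by rewrite -bait_opt; apply: le_lt_trans fin; exact: ratio_le.
have E1 : (1 <= expected_cost A (trap_input (k + k)))%E.
  move: E0; rewrite /expected_cost unlock => E0.
  (* A nonnegative cost with zero expectation vanishes almost everywhere, so [bait_taken] applies to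
     almost every run. *)
  have ae0 : ae_eq (ra_prob A) setT
      (fun w => (cost d (ra_run A w (trap_input k)))%:E) (cst 0%E).
    apply/ae_eq_integral_abs => //; first exact: mc.
    by rewrite -[RHS]E0; apply: eq_integral => w _; rewrite gee0_abs ?lee_fin ?c_ge0.
  have <- : (\int[ra_prob A]_w (cst 1 w) = 1 :> \bar R)%E.
    by rewrite integral_cst//= probability_setT mule1.
  apply: ae_ge0_le_integral => //.
  - by move=> w _; rewrite lee_fin c_ge0.
  - exact: mc.
  apply: filterS ae0 => w w0 _; rewrite lee_fin.
  by apply: bait_taken; [exact: ra_online|have := w0 I => -[]].
apply: le_trans (ratio_le _ inp1); apply: le_ratio => //.
- by rewrite invr_gt0 !mulr_gt0.
- exact: cost_opt_ge0.
- by rewrite invrK; exact: trap_opt.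
Qed.
End Trap.

(** * Choice of [e] against a given bound [f] *)

Theorem theorem3 (R : realType) (k : nat) (hk : (4 <= k)%N) :
  ~ exists (ALG : forall (V : finType) (d : n_metric R k V),
                    randomized_algorithm d)
           (f : nat -> R),
      forall (V : finType) (d : n_metric R k V),
        (competitive_ratio (ALG V d) <= (f #|V|)%:E)%E.
Proof.
move=> [ALG [f ALGf]].
(* [C] depends only on the value of [f] at three points, whereas the metric, and the algorithm with
   it, may depend on [e]. This [e] turns the lower bound of [trap_ratio] into [C > f 3], and
   [C >= 1] ensures [e <= 1]. *)
pose C := `|f 3| + 1; pose e := (2 * k.+1%:R * C)^-1.
have C1 : 1 <= C by rewrite lerDr.
have fC : f 3 < C by rewrite ltr_pwDr// ler_norm.
have K1 : 1 <= 2 * k.+1%:R :> R by rewrite -natrM ler1n.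
have e_gt0 : 0 < e by rewrite invr_gt0; nra.
have e_le1 : e <= 1 by rewrite invf_le1; nra.
have eC : (2 * k.+1%:R * e)^-1 = C.
  by rewrite -[RHS]invrK; congr (_^-1); rewrite /e [X in _ * X]invfM mulVKf//.
pose d := gap_metric e (ord0 : 'I_3) (ltnW (ltnW hk)) e_gt0 e_le1.
have := ALGf _ d; rewrite card_ord => ratio_le.
have : (C%:E <= competitive_ratio (ALG _ d))%E.
  rewrite -eC; apply: (trap_ratio _ _ (inord 1) (inord 2)).
  - by apply/eqP => /(congr1 val); rewrite /= inordK.
  - by apply/eqP => /(congr1 val); rewrite /= inordK.
  - by apply/eqP => /(congr1 val); rewrite /= !inordK.
  - exact: le_lt_trans ratio_le (ltry _).
by move=> /le_trans/(_ ratio_le); rewrite lee_fin leNgt fC.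
Qed.
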